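(* Let $p$ be a prime and let $S/R$ be a finite extension of discrete valuation rings of characteristic $p$ (not necessarily complete, residue fields not necessarily perfect), with corresponding extension of fields of fractions $L/K$. Let $n=[L:K]$, let $v_L$ be the normalised valuation on $L$ associated to $S$, and let $w=v_L(\mathcal{D}_{S/R})$. Suppose $L/K$ is separable and is $H$-Galois for some $K$-Hopf algebra $H$. If $S/R$ is totally ramified, $n$ is a power of $p$, and $b\in\mathbb{Z}$ satisfies $b\equiv -w-1 \pmod n$, then every $\rho\in L$ with $v_L(\rho)=b$ is a normal basis generator for $L/K$ with respect to $H$.
   Context: Valuations are normalised so that $v_L(L)=\mathbb{Z}\cup\{\infty\}$. The different $\mathcal{D}_{S/R}$ is the fractional $S$-ideal with $\mathcal{D}_{S/R}^{-1}=\{x\in L : \mathrm{Tr}_{L/K}(xS)\subseteq R\}$. A finite separable extension $L/K$ is $H$-Galois, for a $K$-Hopf algebra $H$, if $L$ is an $H$-module algebra and the map $H\to\mathrm{End}_K(L)$ giving the action extends to an $L$-linear isomorphism $L\otimes_K H\to \mathrm{End}_K(L)$. In that case $L$ is a free $H$-module of rank $1$, and a normal basis generator for $L/K$ with respect to $H$ means a free generator of the $H$-module $L$. *)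

(* Defs.v *)
From HB Require Import structures.
From mathcomp Require Import all_boot all_order all_algebra all_field.
Set Implicit Arguments. Unset Strict Implicit. Unset Printing Implicit Defensive.
Import Order.TTheory GRing.Theory Num.Theory.
Local Open Scope ring_scope.

Section Defs.
Variables (K : fieldType) (L : fieldExtType K).

(* v is only meaningful on nonzero elements; v 0 (= infinity) is never used.   *)
Definition normalised_discrete_valuation (v : L -> int) : Prop :=
  [/\ forall x y, x != 0 -> y != 0 -> v (x * y) = v x + v y,
      forall x y, x != 0 -> y != 0 -> x + y != 0 ->
        Num.min (v x) (v y) <= v (x + y)
    & forall z : int, exists2 x, x != 0 & v x = z].

Definition inS (v : L -> int) (x : L) : bool := (x == 0) || (0 <= v x).
Definition inR (v : L -> int) (a : K) : bool := inS v (a%:A).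

Definition S_finite_over_R (v : L -> int) : Prop :=
  exists s : seq L, all (inS v) s /\
    forall x, inS v x -> exists c : nat -> K,
      (forall i, inR v (c i)) /\ x = \sum_(i < size s) c i *: s`_i.

Definition totally_ramified (v : L -> int) : Prop :=
  (forall a : K, a != 0 -> ((\dim {:L})%:Z %| v (a%:A))%Z) /\
  exists2 a : K, a != 0 & v (a%:A) = (\dim {:L})%:Z.

Definition trLK (x : L) : K :=
  \tr (passmx.mxof (vbasis {:L}) (vbasis {:L}) (amulr x)).

Definition in_inv_different (v : L -> int) (x : L) : Prop :=
  forall s, inS v s -> inR v (trLK (x * s)).

(* w = v_L(D_{S/R}): D^{-1} = pi_L^{-w} S *)
Definition different_valuation (v : L -> int) (w : int) : Prop :=
  forall x, in_inv_different v x <-> (x = 0 \/ - w <= v x).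

(* H has K-basis h_0, ..., h_{m-1};
   h_i h_j = sum_k mul i j k h_k,       1_H = sum_k unit k h_k,
   Delta h_i = sum_{a,b} comul i a b h_a (x) h_b,   eps h_i = counit i,
   S h_i = sum_j antip i j h_j. *)
Record hopf_data (m : nat) := HopfData {
  hmul : 'I_m -> 'I_m -> 'I_m -> K;
  hunit : 'I_m -> K;
  hcomul : 'I_m -> 'I_m -> 'I_m -> K;
  hcounit : 'I_m -> K;
  hantip : 'I_m -> 'I_m -> K
}.

Definition delta m (i j : 'I_m) : K := (i == j)%:R.

Definition is_hopf_algebra m (H : hopf_data m) : Prop :=
  let mu := hmul H in let u := hunit H in let D := hcomul H in
  let e := hcounit H in let s := hantip H in
  [/\ [/\
      forall i j l t, \sum_k mu i j k * mu k l t = \sum_k mu j l k * mu i k t,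
      forall i t, \sum_k u k * mu k i t = delta i t /\ \sum_k u k * mu i k t = delta i t,
      forall i a b c, \sum_k D i k c * D k a b = \sum_k D i a k * D k b c
    &
      forall i b, \sum_a e a * D i a b = delta i b /\ \sum_a D i b a * e a = delta i b],
      (forall i j a b, \sum_k mu i j k * D k a b =
         \sum_a1 \sum_b1 \sum_a2 \sum_b2
            D i a1 b1 * D j a2 b2 * mu a1 a2 a * mu b1 b2 b) /\
      (forall a b, \sum_k u k * D k a b = u a * u b),
      (forall i j, \sum_k mu i j k * e k = e i * e j) /\ \sum_k u k * e k = 1
    &
      forall i t,
        \sum_a \sum_b \sum_c D i a b * s a c * mu c b t = e i * u t /\
        \sum_a \sum_b \sum_c D i a b * s b c * mu a c t = e i * u t].

Definition is_module_algebra m (H : hopf_data m) (act : 'I_m -> 'End(L)) : Prop :=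
  [/\ forall i j x, act i (act j x) = \sum_k hmul H i j k *: act k x,
      forall x, \sum_k hunit H k *: act k x = x,
      forall i x y, act i (x * y) =
        \sum_a \sum_b hcomul H i a b *: (act a x * act b y)
    & forall i, act i 1 = hcounit H i *: 1].

(* H-Galois: L (x)_K H -> End_K(L), x (x) h |-> (y |-> x (h . y)) is bijective.
   An element of L (x)_K H is written uniquely as sum_i y_i (x) h_i. *)
Definition is_H_Galois m (H : hopf_data m) (act : 'I_m -> 'End(L)) : Prop :=
  is_hopf_algebra H /\ is_module_algebra H act /\
  (forall f : 'End(L), exists y : 'I_m -> L,
      forall z, f z = \sum_i y i * act i z) /\
  (forall y y' : 'I_m -> L,
      (forall z, \sum_i y i * act i z = \sum_i y' i * act i z) ->
      forall i, y i = y' i).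

Definition normal_basis_generator m (H : hopf_data m) (act : 'I_m -> 'End(L))
  (rho : L) : Prop :=
  (forall x : L, exists c : 'I_m -> K, x = \sum_i c i *: act i rho) /\
  (forall c c' : 'I_m -> K,
     \sum_i c i *: act i rho = \sum_i c' i *: act i rho -> forall i, c i = c' i).

End Defs.

(* Main.v *)
(* An element rho of trace nonzero is a normal basis generator.  Over a field E
   splitting L, the Galois condition identifies each K-embedding sigma_x of L
   into E with the action of a grouplike element g_x of E (x) H, so that
   E (x) H is the group algebra of the finite group N = {g_x} of order n = p^k.
   Moreover rho generates as soon as the matrix (sigma_(yx) rho)_(x, y), indexed
   by N, is invertible; as N is a p-group and E has characteristic p, this holds
   when sum_x sigma_x rho, the trace of rho, is nonzero.
   For the valuation condition, scale rho by an element of K to get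
   v rho = - w - 1.  Total ramification makes the residue extension trivial, so
   S = R + pi S; a zero trace would thus put rho in the inverse different, whose
   elements have valuation at least - w. *)

Require Import Defs.
From HB Require Import structures.
From mathcomp Require Import all_boot all_order all_fingroup all_algebra.
From mathcomp Require Import all_solvable all_field all_character.
From mathcomp Require Import ring zify.
Set Implicit Arguments. Unset Strict Implicit. Unset Printing Implicit Defensive.
Import Order.TTheory GRing.Theory Num.Theory.
Local Open Scope ring_scope.

(** * Group tables of [p]-groups in characteristic [p] *)

(* A nonzero kernel would be a module over the p-group, hence contain a nonzero
   invariant vector; by transitivity that vector is constant. *)
Lemma pgroup_table_unitmx (F : fieldType) (p k n : nat) (pi : 'I_n -> 'S_n)
    (e : 'I_n) (s : 'I_n -> F) :
  prime p -> p \in [pchar F] -> n = (p ^ k)%N ->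
  pi e = 1%g -> (forall x, pi x e = x) ->
  (forall x y, (pi x * pi y)%g = pi (pi y x)) ->
  \sum_x s x != 0 ->
  \matrix_(x, y) s (pi y x) \in unitmx.
Proof.
move=> p_pr charF En pi1 pie piM s_neq0.
have pi_inj : injective pi by move=> x y Exy; rewrite -(pie x) Exy pie.
have groupG : group_set [set pi x | x : 'I_n].
  apply/group_setP; split; first by apply/imsetP; exists e.
  by move=> _ _ /imsetP[x _ ->] /imsetP[y _ ->]; rewrite piM imset_f.
pose G := Group groupG.
have pG : (p.-group G)%g.
  by rewrite /pgroup card_imset // card_ord En pnatX pnat_id.
have reprP : mx_repr G (@perm_mx F n).
  by split=> [|x y _ _]; [exact: perm_mx1 | exact: perm_mxM].
pose rG := MxRepresentation reprP.
set M := \matrix_(_, _) _.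
have modM : mxmodule rG (kermx M).
  apply/mxmoduleP=> _ /imsetP[z _ ->]; apply/sub_kermxP/row_matrixP=> i.
  rewrite row0 -mulmxA row_mul; set a := row i _.
  have aM : a *m M = 0 by rewrite -row_mul mulmx_ker row0.
  (* Entry [y] of the permuted vector times [M] is entry [pi y z] of [a *m M], hence zero. *)
  apply/rowP=> y; rewrite -row_permE mxE [RHS]mxE.
  move/rowP/(_ (pi y z)): aM; rewrite !mxE => aM; rewrite -[RHS]aM.
  apply: eq_bigr => x _; rewrite !mxE; congr (_ * s _).
  by rewrite -permM piM.
rewrite -row_free_unit -kermx_eq0; apply/negPn/negP=> kerM.
have := rfix_pgroup_pchar charF (submod_repr modM) _ pG (subxx _).
rewrite lt0n mxrank_eq0 => /(_ kerM) /rowV0Pn[u /rfix_mxP fix_u u_neq0].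
pose v := val_submod u.
have v_neq0 : v != 0 by rewrite val_submod_eq0.
have vM : v *m M = 0 by apply/sub_kermxP; apply: val_submodP.
have vE x : v 0 x = v 0 e.
  have Gx : pi x \in G by apply: imset_f.
  have := val_submodJ modM u Gx; rewrite fix_u // -/v /= => Ev.
  rewrite {1}Ev -{1}[pi x]invgK -col_permE mxE; congr (v 0 _).
  by rewrite -[X in (pi x)^-1%g X]pie permK.
case/negP: v_neq0; apply/eqP/rowP=> x; rewrite vE [RHS]mxE.
(* Entry [e] of [v *m M] is the constant value of [v] times the nonzero sum of [s]. *)
move/rowP/(_ e): vM; rewrite [LHS]mxE [RHS]mxE.
under eq_bigr => y _ do rewrite vE [M _ _]mxE pi1 perm1.
by rewrite -mulr_sumr => /eqP; rewrite mulf_eq0 (negPf s_neq0) orbF => /eqP.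
Qed.

(** * Splitting fields over an abstract field *)

(* The double negations stand in for the undecidability of irreducibility over
   an abstract field. *)
Lemma irreducible_divisor (F : fieldType) (q : {poly F}) :
  (1 < size q)%N -> ~ ~ exists2 d, irreducible_poly d & d %| q.
Proof.
have [n] := ubnP (size q); elim: n q => // n IHn q /ltnSE leqn q_gt1 nodiv.
apply: (nodiv); exists q => //; split=> // d d_neq1 dvdq; apply/negPn/negP => ndq.
have q_neq0 : q != 0 by rewrite -size_poly_gt0 ltnW.
have d_gt1 : (1 < size d)%N.
  have: (0 < size d)%N by rewrite size_poly_gt0 (dvdpN0 dvdq).
  by case: (size d) d_neq1 => [|[|]].
have ltdq : (size d < size q)%N.
  rewrite ltn_neqAle dvdp_leq // andbT; apply: contra ndq => szd.
  by rewrite -(dvdp_size_eqp dvdq).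
apply: (IHn d (leq_trans ltdq leqn) d_gt1) => -[c irr_c dvdc].
apply: nodiv.
by exists c => //; apply: dvdp_trans dvdq.
Qed.

(** Induction on the size of [q]: a root of an irreducible divisor is adjoined and its linear factor
    split off. The double negation is inherited from [irreducible_divisor]. *)
Lemma splitting_extension (F : fieldType) (q : {poly F}) :
  q != 0 -> ~ ~ exists (E : fieldType) (f : {rmorphism F -> E}) (rs : seq E),
     map_poly f q %= \prod_(r <- rs) ('X - r%:P).
Proof.
have [n] := ubnP (size q); elim: n F q => // n IHn F q /ltnSE leqn q_neq0 nosplit.
have [q_gt1|q_le1] := ltnP 1 (size q); last first.
  apply: nosplit; exists F, idfun, [::]; rewrite big_nil map_poly_id //.
  by rewrite -size_poly_eq1 eqn_leq q_le1 size_poly_gt0.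
apply: (irreducible_divisor q_gt1) => -[d irr_d dvdq].
have [L _ [z root_z _]] := irredp_FAdjoin irr_d.
pose g : {rmorphism F -> L} := in_alg L.
have /factor_theorem[q1 Dq1] : root (map_poly g q) z.
  have: map_poly g d %| map_poly g q by rewrite dvdp_map.
  by move/dvdpP=> [c ->]; rewrite rootM root_z orbT.
have gq_neq0 : map_poly g q != 0 by rewrite map_poly_eq0.
have q1_neq0 : q1 != 0 by apply: contraNneq gq_neq0 => q10; rewrite Dq1 q10 mul0r.
have szq1 : (size q1 < n)%N.
  rewrite (leq_trans _ leqn) // -(size_map_poly g) Dq1 size_Mmonic ?monicXsubC //.
  by rewrite size_XsubC addn2.
apply: (IHn L q1 szq1 q1_neq0) => -[E [f [rs Drs]]].
apply: nosplit; exists E, (f \o g), (f z :: rs).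
rewrite big_cons map_poly_comp Dq1 rmorphM /= map_polyXsubC mulrC.
by rewrite eqp_mul2l ?polyXsubC_eq0.
Qed.

(** * Embeddings of a simple extension *)

Section KHom.
Variables (K : fieldType) (L : fieldExtType K) (E : fieldType).
Variable iota : {rmorphism L -> E}.
Implicit Types T : L -> E.

(** [E] is a bare field without a [K]-algebra structure, so scalars from [K] act on it through [L]
    and [iota]. *)
Definition klinear T :=
  forall a x y, T (a *: x + y) = iota a%:A * T x + T y.

Definition khom T := [/\ klinear T, T 1 = 1 & {morph T : x y / x * y}].

Section Klinear.
Variable T : L -> E.
Hypothesis linT : klinear T.

Lemma klinear0 : T 0 = 0.
Proof.
by have := linT (-1) 0 0; rewrite scaler0 addr0 !scaleN1r rmorphN1 mulN1r addNr.
Qed.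

Lemma klinearZ a x : T (a *: x) = iota a%:A * T x.
Proof. by rewrite -[a *: x]addr0 linT klinear0 addr0. Qed.

Lemma klinearD x y : T (x + y) = T x + T y.
Proof. by rewrite -{1}[x]scale1r linT scale1r rmorph1 mul1r. Qed.

Lemma klinear_sum (I : finType) (G : I -> L) : T (\sum_i G i) = \sum_i T (G i).
Proof. exact: (big_morph T klinearD klinear0). Qed.

Lemma klinear_coord n (e : n.-tuple L) x : basis_of {:L} e ->
  T x = \sum_i iota (coord e i x)%:A * T e`_i.
Proof.
move=> basis_e; rewrite {1}(coord_basis basis_e (memvf x)) klinear_sum.
by apply: eq_bigr => i _; rewrite klinearZ.
Qed.
End Klinear.

Lemma khom_horner T (q : {poly L}) x : khom T -> q \is a polyOver 1%VS ->
  T q.[x] = (map_poly iota q).[T x].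
Proof.
case=> linT T1 TM q1; rewrite (horner_coef_wide _ (leqnn _)) klinear_sum //.
rewrite (horner_coef_wide _ (size_poly _ _)); apply: eq_bigr => i _.
rewrite coef_map /=; have /vlineP[a ->] := polyOverP q1 i.
rewrite -scalerAl mul1r klinearZ //; congr (_ * _).
by elim: {i}(val i) => [|i IHi]; rewrite ?expr0 // !exprS TM IHi.
Qed.

Section Simple.
Variable alpha : L.
Hypothesis gen_alpha : <<1; alpha>>%VS = {:L}%VS.
Let mu := minPoly 1 alpha.

Lemma khom_root T : khom T -> root (map_poly iota mu) (T alpha).
Proof.
move=> homT; rewrite /root -khom_horner ?minPolyOver // minPolyxx.
by case: homT => /klinear0->.
Qed.

Lemma khom_gen_inj T T' : khom T -> khom T' -> T alpha = T' alpha -> T =1 T'.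
Proof.
move=> homT homT' eqT x.
have Lx : x \in <<1; alpha>>%VS by rewrite gen_alpha memvf.
by rewrite -(Fadjoin_poly_eq Lx) !khom_horner ?Fadjoin_polyOver // eqT.
Qed.

(** [T] writes an element as a polynomial in [alpha] and evaluates it at [r]. As [r] is a root of
    the minimal polynomial, reduction modulo the latter does not change the value, which makes [T]
    multiplicative. *)
Lemma khom_of_root r : root (map_poly iota mu) r ->
  exists2 T, khom T & T alpha = r.
Proof.
move=> mu_r; pose T x := (map_poly iota (Fadjoin_poly 1 alpha x)).[r].
have Lx x : x \in <<1; alpha>>%VS by rewrite gen_alpha memvf.
have TE q : q \is a polyOver 1%VS -> T q.[alpha] = (map_poly iota q).[r].
  move=> q1; rewrite /T Fadjoin_poly_mod // map_modp.
  rewrite {2}(divp_eq (map_poly iota q) (map_poly iota mu)).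
  by rewrite hornerD hornerM (rootP mu_r) mulr0 add0r.
have P1 := Fadjoin_polyOver 1 alpha.
exists T; first split.
- by move=> a x y; rewrite /T linearP /= rmorphD /= map_polyZ hornerD hornerZ.
- by rewrite -[X in T X](hornerC 1 alpha) TE ?rpred1 // rmorph1 hornerC.
- move=> x y; rewrite -{1}(Fadjoin_poly_eq (Lx x)) -{1}(Fadjoin_poly_eq (Lx y)).
  by rewrite -hornerM TE ?rpredM // rmorphM hornerM.
by rewrite -{1}(hornerX alpha) TE ?polyOverX // map_polyX hornerX.
Qed.
End Simple.
End KHom.

(** * Embeddings of a separable extension, and the trace *)

(** The minimal polynomial of a primitive element is split over [L], so that [E] receives [L]
    through [iota]. Separability makes the roots distinct, and each root gives one embedding. The
    last clause is the independence of the embeddings over [E]. *)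
Lemma separable_embeddings (K : fieldType) (L : fieldExtType K) :
  separable 1%VS {:L} -> ~ ~ exists (E : fieldType) (iota : {rmorphism L -> E})
    (sigma : 'I_(\dim {:L}) -> L -> E),
  [/\ forall x, khom iota (sigma x),
      forall T, khom iota T -> exists x, T =1 sigma x
    & \matrix_(x, j) sigma x (vbasis {:L})`_j \in unitmx].
Proof.
move=> sepL; pose alpha := separable_generator 1 {:L}.
have gen_alpha : <<1; alpha>>%VS = {:L}%VS.
  by rewrite -eq_adjoin_separable_generator ?sub1v.
pose mu := minPoly 1 alpha.
have sep_mu : separable_poly mu.
  have := separable_generatorP {:L}%AS 1%AS.
  by rewrite /separable_element unlock.
have mu_neq0 : mu != 0 by rewrite monic_neq0 ?monic_minPoly.
have dimL : adjoin_degree 1 alpha = \dim {:L}.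
  by rewrite -[RHS]/(\dim {:L}%VS) -gen_alpha dim_Fadjoin dimv1 muln1.
move=> noE; apply: (splitting_extension mu_neq0) => -[E [iota [rs Drs]]].
have size_rs : size rs == \dim {:L}.
  rewrite -eqSS -(size_prod_XsubC _ id) -(eqp_size Drs) size_map_poly.
  by rewrite size_minPoly dimL.
have uniq_rs : uniq rs.
  by rewrite -separable_prod_XsubC -(eqp_separable Drs) separable_map.
have rootE r : root (map_poly iota mu) r = (r \in rs).
  by rewrite (eqp_root Drs) root_prod_XsubC.
have hom_r (x : 'I_(\dim {:L})) : exists T, khom iota T /\ T alpha = rs`_x.
  have: root (map_poly iota mu) rs`_x.
    by rewrite rootE mem_nth // (eqP size_rs).
  by case/(khom_of_root gen_alpha) => T; exists T.
have [sigma hom_sigma] := fin_all_exists hom_r.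
have homs x := (hom_sigma x).1; have sigma_alpha x := (hom_sigma x).2.
apply: noE; exists E, iota, sigma; split=> // [T homT|].
  have := khom_root alpha homT; rewrite rootE => /(nthP 0)[i lti ET].
  rewrite (eqP size_rs) in lti; exists (Ordinal lti).
  by apply: (khom_gen_inj gen_alpha homT (homs _)); rewrite sigma_alpha.
set B := \matrix_(_, _) _.
pose V := Vandermonde (\dim {:L}) (\row_x rs`_(x : 'I_(\dim {:L}))).
have V_unit : V \in unitmx.
  rewrite unitmxE det_Vandermonde unitfE; apply/prodf_neq0 => i _.
  apply/prodf_neq0 => j lt_ij; rewrite !mxE subr_eq0 nth_uniq ?(eqP size_rs) //.
  by rewrite neq_ltn lt_ij orbT.
(* Expanding the powers of [alpha] in the basis of [L] factors the Vandermonde matrix of the roots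
   through the transpose of [B]. *)
have: V = \matrix_(j, k) iota (coord (vbasis {:L}) k (alpha ^+ j))%:A *m B^T.
  apply/matrixP => j x; rewrite !mxE -sigma_alpha.
  have [linx x1 xM] := homs x.
  have <- : sigma x (alpha ^+ j) = sigma x alpha ^+ j.
    by elim: (val j) => [|i IHi]; rewrite ?expr0 // !exprS xM IHi.
  rewrite (klinear_coord linx _ (vbasisP {:L})).
  by apply: eq_bigr => k _; rewrite !mxE.
by move=> DV; move: V_unit; rewrite DV unitmx_mul unitmx_tr => /andP[].
Qed.

(** Over [E], the transpose of [B] conjugates the matrix of multiplication by [x] into the diagonal
    matrix of the [sigma i x]. *)
Lemma khom_trace (K : fieldType) (L : fieldExtType K) (E : fieldType)
    (iota : {rmorphism L -> E}) (sigma : 'I_(\dim {:L}) -> L -> E) (x : L) :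
  (forall i, khom iota (sigma i)) ->
  \matrix_(i, j) sigma i (vbasis {:L})`_j \in unitmx ->
  iota (trLK x)%:A = \sum_i sigma i x.
Proof.
move=> homs; set B := \matrix_(_, _) _ => B_unit.
pose kappa : {rmorphism K -> E} := iota \o in_alg L.
pose M := passmx.mxof (vbasis {:L}) (vbasis {:L}) (amulr x).
pose D := diag_mx (\row_i sigma i x).
have ME : map_mx kappa M *m B^T = B^T *m D.
  apply/matrixP => j i; rewrite mul_mx_diag !mxE.
  have [lini _ iM] := homs i; rewrite -iM.
  rewrite (klinear_coord lini _ (vbasisP {:L})); apply: eq_bigr => k _.
  rewrite !mxE; congr (iota _%:A * _).
  have <- : amulr x (vbasis {:L})`_j = (vbasis {:L})`_j * x by rewrite lfunE.
  have basisL := vbasisP {:L}.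
  rewrite passmx.coord_rVof -(passmx.rVofE basisL) passmx.rVofK //.
  by rewrite -passmx.coord_rVof.
rewrite -[LHS]/(kappa (\tr M)) -trace_map_mx.
have -> : map_mx kappa M = B^T *m D *m invmx B^T.
  by rewrite -ME mulmxK // unitmx_tr.
rewrite mxtrace_mulC mulmxA mulVmx ?unitmx_tr // mul1mx mxtrace_diag.
by apply: eq_bigr => i _; rewrite mxE.
Qed.

(** * The Galois condition in coordinates *)

(** A row [y] over [L] stands for an element of [L (x) H], and [y *m A] lists the values of its
    endomorphism on the basis of [L]. Injectivity and surjectivity of the Galois map become the two
    rank conditions, which together force [m = \dim {:L}]. *)
Lemma galois_action_mx (K : fieldType) (L : fieldExtType K) m
    (H : hopf_data K m) (act : 'I_m -> 'End(L)) :
  is_H_Galois H act ->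
  let A := \matrix_(i < m, j < \dim {:L}) act i (vbasis {:L})`_j in
  row_free A /\ row_full A.
Proof.
case=> _ [_ [act_onto act_inj]] A; pose e := vbasis {:L}.
have AE (y : 'rV_m) z :
    \sum_i y 0 i * act i z = \sum_j (coord e j z)%:A * (y *m A) 0 j.
  under [RHS]eq_bigr => j _ do rewrite mxE mulr_sumr.
  rewrite exchange_big; apply: eq_bigr => i _ /=.
  rewrite {1}(coord_basis (vbasisP {:L}) (memvf z)) linear_sum mulr_sumr.
  apply: eq_bigr => j _; rewrite linearZ mxE /=.
  by rewrite -scalerAr -scalerAl mul1r.
split.
  apply: inj_row_free => y yA0; apply/rowP => i; rewrite [RHS]mxE.
  apply: (act_inj (fun i => y 0 i) (fun=> 0)) => z.
  rewrite AE yA0 !big1 // => j _; first by rewrite mul0r.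
  by rewrite mxE mulr0.
rewrite -sub1mx; apply/row_subP => j; set u := row j _.
(* The [j]-th coordinate function, read as an endomorphism with image in the line of [1], takes on
   the basis the values in row [j] of the identity matrix. *)
pose f z : L := (coord e j z)%:A.
have lin_f : linear f by move=> a x y; rewrite /f linearP scalerDl scalerA.
pose fL : {linear L -> L} := HB.pack f (GRing.isLinear.Build K L L _ f lin_f).
have [y Dy] := act_onto (linfun fL).
apply/submxP; exists (\row_i y i); apply/rowP => k.
have -> : u 0 k = \sum_i y i * act i e`_k.
  rewrite -Dy lfunE /= /f coord_free ?(basis_free (vbasisP {:L})) // !mxE.
  by rewrite eq_sym; case: (k == j); rewrite ?scale1r ?scale0r.
by rewrite mxE; apply: eq_bigr => i _; rewrite !mxE.
Qed.

(** * The Hopf algebra [E (x) H] and its grouplike elements *)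

Section ScalarExtension.
Variables (K : fieldType) (L : fieldExtType K) (E : fieldType).
Variable iota : {rmorphism L -> E}.
Variables (n : nat) (H : hopf_data K n) (act : 'I_n -> 'End(L)).
Hypotheses (hopfH : is_hopf_algebra H) (modH : is_module_algebra H act).
Variable kappa : {rmorphism K -> E}.
Hypothesis kappaE : forall a, iota a%:A = kappa a.
Implicit Types h k l : 'rV[E]_n.

(* A row vector h over E stands for the element with coordinates h in the basis
   1 (x) h_i of E (x) H, and [ext_act h] is its action on L, with values in E
   through iota. *)
Definition ext_act h z := \sum_i h 0 i * iota (act i z).
Definition ext_mul h k : 'rV[E]_n :=
  \row_t \sum_i \sum_j h 0 i * k 0 j * kappa (hmul H i j t).
Definition ext_unit : 'rV[E]_n := \row_i kappa (hunit H i).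
Definition ext_antip h : 'rV[E]_n := \row_c \sum_a h 0 a * kappa (hantip H a c).
Definition grouplike h :=
  (forall a b, \sum_i h 0 i * kappa (hcomul H i a b) = h 0 a * h 0 b) /\
  \sum_i h 0 i * kappa (hcounit H i) = 1.

Lemma iotaZ a x : iota (a *: x) = kappa a * iota x.
Proof. by rewrite -kappaE -rmorphM -scalerAl mul1r. Qed.

Lemma ext_act_klinear h : klinear iota (ext_act h).
Proof.
move=> a x y; rewrite /ext_act mulr_sumr -big_split; apply: eq_bigr => i _ /=.
by rewrite linearP rmorphD iotaZ kappaE mulrDr mulrCA.
Qed.

(** [ext_act] has arguments in [L] and values in [E], so two such actions do not compose; the module
    law is stated with the inner action still in [L]. *)
Lemma ext_act_mul h k z :
  ext_act (ext_mul h k) z =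
  \sum_i \sum_j h 0 i * k 0 j * iota (act i (act j z)).
Proof.
have [actM _ _ _] := modH; rewrite /ext_act.
under eq_bigr => t _.
  rewrite mxE mulr_suml; under eq_bigr => i _ do rewrite mulr_suml.
  over.
rewrite exchange_big; apply: eq_bigr => i _ /=.
rewrite exchange_big; apply: eq_bigr => j _ /=.
rewrite actM rmorph_sum mulr_sumr; apply: eq_bigr => t _ /=.
by rewrite iotaZ mulrA.
Qed.

Lemma ext_mulA h k l : ext_mul h (ext_mul k l) = ext_mul (ext_mul h k) l.
Proof.
have [[mulA _ _ _] _ _ _] := hopfH; apply/rowP => t; rewrite !mxE.
transitivity (\sum_i \sum_j \sum_r
   h 0 i * k 0 j * l 0 r * kappa (\sum_s hmul H j r s * hmul H i s t)).
  apply: eq_bigr => i _.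
  under eq_bigr => s _.
    rewrite mxE mulr_sumr mulr_suml.
    under eq_bigr => j _ do rewrite mulr_sumr mulr_suml.
    over.
  rewrite exchange_big; apply: eq_bigr => j _ /=.
  rewrite exchange_big; apply: eq_bigr => r _ /=.
  rewrite rmorph_sum mulr_sumr; apply: eq_bigr => s _.
  by rewrite rmorphM /= !mulrA.
under [RHS]eq_bigr => s _.
  under eq_bigr => r _.
    rewrite mxE mulr_suml mulr_suml.
    under eq_bigr => i _ do rewrite mulr_suml mulr_suml.
    over.
  rewrite exchange_big.
  under eq_bigr => i _ do rewrite exchange_big.
  over.
rewrite [RHS]exchange_big; apply: eq_bigr => i _ /=.
rewrite [RHS]exchange_big; apply: eq_bigr => j _ /=.
rewrite [RHS]exchange_big; apply: eq_bigr => r _ /=.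
rewrite -mulA rmorph_sum mulr_sumr.
apply: eq_bigr => s _; rewrite rmorphM /= !mulrA; congr (_ * _).
by rewrite mulrAC.
Qed.

Lemma ext_mul1l h : ext_mul ext_unit h = h.
Proof.
have [[_ unitP _ _] _ _ _] := hopfH; apply/rowP => t; rewrite !mxE exchange_big.
transitivity (\sum_j h 0 j * kappa (delta K j t)).
  apply: eq_bigr => j _; have [<- _] := unitP j t.
  rewrite rmorph_sum mulr_sumr; apply: eq_bigr => i _.
  by rewrite mxE rmorphM [LHS]mulrAC mulrC.
rewrite (bigD1 t) //= big1 => [|j nejt].
  by rewrite /delta eqxx rmorph1 mulr1 addr0.
by rewrite /delta (negPf nejt) rmorph0 mulr0.
Qed.

Lemma ext_mul1r h : ext_mul h ext_unit = h.
Proof.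
have [[_ unitP _ _] _ _ _] := hopfH; apply/rowP => t; rewrite !mxE.
transitivity (\sum_j h 0 j * kappa (delta K j t)).
  apply: eq_bigr => j _; have [_ <-] := unitP j t.
  rewrite rmorph_sum mulr_sumr; apply: eq_bigr => i _.
  by rewrite mxE rmorphM mulrA.
rewrite (bigD1 t) //= big1 => [|j nejt].
  by rewrite /delta eqxx rmorph1 mulr1 addr0.
by rewrite /delta (negPf nejt) rmorph0 mulr0.
Qed.

Lemma grouplike_unit : grouplike ext_unit.
Proof.
have [_ [_ unitD] [_ unit_eps] _] := hopfH; split=> [a b|].
  rewrite !mxE -rmorphM -unitD rmorph_sum; apply: eq_bigr => i _.
  by rewrite mxE rmorphM.
rewrite -(rmorph1 kappa) -unit_eps rmorph_sum; apply: eq_bigr => i _.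
by rewrite mxE rmorphM.
Qed.

(** Comultiplication and counit are algebra maps, so the coproduct of the product regroups into the
    coproducts of [h] and [k]. *)
Lemma grouplike_mul h k : grouplike h -> grouplike k -> grouplike (ext_mul h k).
Proof.
have [_ [mulD _] [mul_eps _] _] := hopfH => -[hD h_eps] [kD k_eps]; split=> [a b|].
  transitivity (\sum_i \sum_j h 0 i * k 0 j *
      kappa (\sum_t hmul H i j t * hcomul H t a b)).
    under eq_bigr => t _.
      rewrite mxE mulr_suml; under eq_bigr => i _ do rewrite mulr_suml.
      over.
    rewrite exchange_big; apply: eq_bigr => i _.
    rewrite exchange_big; apply: eq_bigr => j _.
    rewrite rmorph_sum mulr_sumr; apply: eq_bigr => t _.
    by rewrite rmorphM mulrA.
  transitivity (\sum_a1 \sum_b1 \sum_a2 \sum_b2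
     (\sum_i h 0 i * kappa (hcomul H i a1 b1)) *
     (\sum_j k 0 j * kappa (hcomul H j a2 b2)) *
     kappa (hmul H a1 a2 a) * kappa (hmul H b1 b2 b)).
    rewrite pair_bigA; under eq_bigr => q _ do rewrite mulD.
    under eq_bigr => q _.
      rewrite rmorph_sum mulr_sumr.
      over.
    rewrite exchange_big; apply: eq_bigr => a1 _.
    under eq_bigr => q _.
      rewrite rmorph_sum mulr_sumr.
      over.
    rewrite exchange_big; apply: eq_bigr => b1 _.
    under eq_bigr => q _.
      rewrite rmorph_sum mulr_sumr.
      over.
    rewrite exchange_big; apply: eq_bigr => a2 _.
    under eq_bigr => q _.
      rewrite rmorph_sum mulr_sumr.
      over.
    rewrite exchange_big; apply: eq_bigr => b2 _.
    rewrite big_distrlr pair_bigA !mulr_suml /=; apply: eq_bigr => q _.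
    rewrite !rmorphM; ring.
  rewrite !mxE [RHS]mulr_suml; apply: eq_bigr => a1 _.
  rewrite [RHS]mulr_sumr; apply: eq_bigr => b1 _.
  rewrite [RHS]mulr_suml; apply: eq_bigr => a2 _.
  rewrite [RHS]mulr_sumr; apply: eq_bigr => b2 _.
  rewrite hD kD; ring.
transitivity (\sum_i \sum_j h 0 i * k 0 j *
    kappa (\sum_t hmul H i j t * hcounit H t)).
  under eq_bigr => t _.
    rewrite mxE mulr_suml; under eq_bigr => i _ do rewrite mulr_suml.
    over.
  rewrite exchange_big; apply: eq_bigr => i _.
  rewrite exchange_big; apply: eq_bigr => j _.
  rewrite rmorph_sum mulr_sumr; apply: eq_bigr => t _.
  by rewrite rmorphM mulrA.
rewrite -[RHS]mulr1 -{1}h_eps -k_eps mulr_suml; apply: eq_bigr => i _.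
rewrite mulr_sumr; apply: eq_bigr => j _.
by rewrite mul_eps rmorphM mulrACA.
Qed.

(** The antipode axiom contracts the coproduct of [h], which here is [h (x) h]. The left inverse so
    obtained gives the cancellation used in [grouplike_perm]. *)
Lemma ext_antipK h : grouplike h -> ext_mul (ext_antip h) h = ext_unit.
Proof.
have [_ _ _ antipP] := hopfH; case=> hD h_eps; apply/rowP => t.
rewrite !mxE -[RHS]mul1r -h_eps mulr_suml.
transitivity (\sum_i h 0 i * kappa (\sum_a \sum_b \sum_c
    hcomul H i a b * hantip H a c * hmul H c b t)); last first.
  by apply: eq_bigr => i _; have [-> _] := antipP i t; rewrite rmorphM mulrA.
under [RHS]eq_bigr => i _.
  rewrite rmorph_sum mulr_sumr.
  over.
rewrite [RHS]exchange_big /=.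
under eq_bigr => c _.
  under eq_bigr => b _ do rewrite mxE !mulr_suml.
  rewrite exchange_big.
  over.
rewrite exchange_big; apply: eq_bigr => a _ /=.
under [RHS]eq_bigr => i _.
  rewrite rmorph_sum mulr_sumr.
  over.
rewrite exchange_big [RHS]exchange_big; apply: eq_bigr => b _ /=.
under [RHS]eq_bigr => i _.
  rewrite rmorph_sum mulr_sumr.
  over.
rewrite [RHS]exchange_big; apply: eq_bigr => c _ /=.
rewrite [_ * h 0 b]mulrAC -hD !mulr_suml; apply: eq_bigr => i _.
by rewrite !rmorphM !mulrA.
Qed.

(** * Grouplike elements as embeddings of [L] *)

Section ActionBasis.
Variable e : n.-tuple L.
Hypothesis basis_e : basis_of {:L} e.
Let A := \matrix_(i < n, j < n) iota (act i e`_j).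
Hypothesis A_unit : A \in unitmx.

Lemma ext_act_mx h j : (h *m A) 0 j = ext_act h e`_j.
Proof. by rewrite mxE; apply: eq_bigr => i _; rewrite mxE. Qed.

Lemma ext_act_inj h k : ext_act h =1 ext_act k -> h = k.
Proof.
move=> eq_hk; apply: (can_inj (mulmxK A_unit)); apply/rowP => j.
by rewrite !ext_act_mx eq_hk.
Qed.

(** Together with [ext_act_inj], this identifies [E (x) H] with the [K]-linear maps from [L] to [E]:
    such a map is its row of values on the basis, and [A] is the change of coordinates. *)
Lemma ext_act_onto T : klinear iota T -> exists h, ext_act h =1 T.
Proof.
move=> linT; exists (\row_j T e`_j *m invmx A) => z.
rewrite (klinear_coord linT z basis_e).
rewrite (klinear_coord (ext_act_klinear _) z basis_e).
by apply: eq_bigr => j _; rewrite -ext_act_mx mulmxKV // mxE.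
Qed.

Lemma ext_actM h x y : ext_act h (x * y) =
  \sum_a \sum_b (\sum_i h 0 i * kappa (hcomul H i a b)) *
     (iota (act a x) * iota (act b y)).
Proof.
have [_ _ actD _] := modH.
transitivity (\sum_i \sum_a \sum_b h 0 i * kappa (hcomul H i a b) *
     (iota (act a x) * iota (act b y))).
  apply: eq_bigr => i _; rewrite actD rmorph_sum mulr_sumr.
  apply: eq_bigr => a _; rewrite rmorph_sum mulr_sumr.
  by apply: eq_bigr => b _; rewrite iotaZ rmorphM mulrA.
rewrite exchange_big; apply: eq_bigr => a _ /=.
rewrite exchange_big; apply: eq_bigr => b _ /=.
by rewrite mulr_suml.
Qed.

Lemma ext_act1 h : ext_act h 1 = \sum_i h 0 i * kappa (hcounit H i).
Proof.
have [_ _ _ act1] := modH.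
by apply: eq_bigr => i _; rewrite act1 kappaE.
Qed.

(** Multiplicativity of [ext_act h] says that the coproduct of [h] and [h (x) h] define the same
    bilinear map on [L]; invertibility of [A] then makes the two tensors equal. *)
Lemma grouplike_khom h : grouplike h <-> khom iota (ext_act h).
Proof.
split=> [[hD h_eps]|[_ h1 hM]].
  split; [exact: ext_act_klinear | by rewrite ext_act1 | move=> x y].
  rewrite ext_actM /ext_act mulr_suml; apply: eq_bigr => a _.
  by rewrite mulr_sumr; apply: eq_bigr => b _; rewrite hD mulrACA.
split=> [a b|]; last by rewrite -ext_act1.
pose D := \matrix_(a, b) \sum_i h 0 i * kappa (hcomul H i a b).
suff : D = h^T *m h by move/matrixP/(_ a b); rewrite !mxE big_ord1 mxE.
(* Sandwiching a tensor between [A^T] and [A] tabulates its bilinear map on pairs of basis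
   vectors. *)
have : A^T *m D *m A = A^T *m (h^T *m h) *m A.
  have -> : A^T *m (h^T *m h) *m A = (h *m A)^T *m (h *m A).
    by rewrite trmx_mul !mulmxA.
  apply/matrixP => j k; rewrite [RHS]mxE big_ord1 [(h *m A)^T _ _]mxE.
  rewrite !ext_act_mx -hM ext_actM.
  rewrite -mulmxA mxE; apply: eq_bigr => c _; rewrite !mxE mulr_sumr.
  by apply: eq_bigr => d _; rewrite !mxE mulrCA.
have At_unit : A^T \in unitmx by rewrite unitmx_tr.
by move/(can_inj (mulmxK A_unit))/(can_inj (mulKmx At_unit)).
Qed.

(** * The group of grouplike elements and the independence of the [act i rho] *)

Section GrouplikeGroup.
Variable sigma : 'I_n -> L -> E.
Hypothesis hom_sigma : forall x, khom iota (sigma x).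
Hypothesis sigma_onto : forall T, khom iota T -> exists x, T =1 sigma x.
Let B := \matrix_(x < n, j < n) sigma x e`_j.
Hypothesis B_unit : B \in unitmx.

(** The matrix of the [g x] times [A] is [B], which is invertible; hence these grouplike elements
    form an [E]-basis of [E (x) H]. *)
Lemma khom_grouplike :
  exists2 g : 'I_n -> 'rV[E]_n,
    (forall x, grouplike (g x)) /\ (forall x, ext_act (g x) =1 sigma x) &
    \matrix_x g x \in unitmx.
Proof.
have sigmaP x : exists h, ext_act h =1 sigma x.
  by case: (hom_sigma x) => /ext_act_onto.
have [g Dg] := fin_all_exists sigmaP; exists g.
  split=> // x; apply/grouplike_khom; have [linx x1 xM] := hom_sigma x.
  split; [exact: ext_act_klinear | by rewrite Dg | by move=> y z; rewrite !Dg].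
have DB : \matrix_x g x *m A = B.
  apply/row_matrixP => x; rewrite row_mul rowK; apply/rowP => j.
  by rewrite ext_act_mx Dg !mxE.
by move: B_unit; rewrite -DB unitmx_mul => /andP[].
Qed.

Lemma grouplike_onto g h : (forall x, ext_act (g x) =1 sigma x) ->
  grouplike h -> exists x, g x = h.
Proof.
move=> Dg /grouplike_khom/sigma_onto[x Dx]; exists x.
by apply: ext_act_inj => z; rewrite Dg Dx.
Qed.

(** [pi x] is left translation by [g x], transported to indices; it is injective because [g x] has a
    left inverse. The index [e0] is that of the unit. *)
Lemma grouplike_perm g :
    (forall x, grouplike (g x)) -> (forall x, ext_act (g x) =1 sigma x) ->
    injective g ->
  exists2 pi : 'I_n -> 'S_n, forall x y, g (pi x y) = ext_mul (g x) (g y) &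
  exists e0, [/\ pi e0 = 1%g, forall x, pi x e0 = x
    & forall x y, (pi x * pi y)%g = pi (pi y x)].
Proof.
move=> grpg Dg g_inj.
have mulP x y : exists z, g z = ext_mul (g x) (g y).
  by apply: (grouplike_onto Dg); apply: grouplike_mul.
have [m Dm] := fin_all_exists (fun x => fin_all_exists (mulP x)).
have m_inj x : injective (m x).
  move=> y z eq_m; apply: g_inj.
  rewrite -[LHS]ext_mul1l -[RHS]ext_mul1l -(ext_antipK (grpg x)).
  by rewrite -!ext_mulA -!Dm eq_m.
exists (fun x => perm (@m_inj x)) => [x y|]; first by rewrite permE Dm.
have [e0 De0] := grouplike_onto Dg grouplike_unit.
exists e0; split=> [|x|x y].
- by apply/permP => x; apply: g_inj; rewrite permE perm1 Dm De0 ext_mul1l.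
- by apply: g_inj; rewrite permE Dm De0 ext_mul1r.
(* Permutations compose from left to right, so [pi x * pi y] is translation by [g y] times [g x], in
   that order. *)
by apply/permP => z; apply: g_inj; rewrite permM !permE !Dm ext_mulA.
Qed.

(** The relation [c] is an element [h] of [E (x) H], expanded as a combination of the [g x] with
    coefficients [a]. Applying each [g y] to the relation gives [a *m M = 0] for the group table [M]
    of the [sigma x rho], and [M] is invertible. *)
Lemma trace_neq0_act_free (p k : nat) rho (c : 'I_n -> K) :
  prime p -> p \in [pchar E] -> n = (p ^ k)%N ->
  \sum_x sigma x rho != 0 -> \sum_i c i *: act i rho = 0 -> forall i, c i = 0.
Proof.
move=> p_pr charE En tr_neq0 c_rho.
have [g [grpg Dg] G_unit] := khom_grouplike; set G := \matrix_x g x in G_unit.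
have g_inj : injective g.
  move=> x y eq_g; apply/eqP/negPn/negP => ne_xy; move: G_unit.
  rewrite unitmxE unitfE; case/negP; apply/eqP.
  by apply: (determinant_alternate ne_xy) => j; rewrite !mxE eq_g.
have [pi Dpi [e0 [pi1 pie piM]]] := grouplike_perm grpg Dg g_inj.
have := pgroup_table_unitmx p_pr charE En pi1 pie piM tr_neq0.
set M := \matrix_(x, y) _ => M_unit.
pose h : 'rV_n := \row_i kappa (c i).
suff h0 : h = 0.
  move=> i; apply/eqP; rewrite -(fmorph_eq0 kappa).
  by move/rowP/(_ i): h0; rewrite !mxE => ->.
pose a := h *m invmx G.
suff a0 : a = 0 by rewrite -(mulmxKV G_unit h) -/a a0 mul0mx.
suff aM : a *m M = 0 by rewrite -(mulmxK M_unit a) aM mul0mx.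
have Dh i : h 0 i = \sum_x a 0 x * g x 0 i.
  by rewrite -(mulmxKV G_unit h) -/a mxE; apply: eq_bigr => x _; rewrite !mxE.
apply/rowP => y; rewrite [LHS]mxE [RHS]mxE.
(* The coefficients [c] lie in [K], so the combination lies in [L] and [g y] can act on it. *)
transitivity (\sum_i g y 0 i * iota (act i (\sum_j c j *: act j rho))); last first.
  by rewrite c_rho; apply: big1 => i _; rewrite linear0 rmorph0 mulr0.
under eq_bigr => x _.
  rewrite [M _ _]mxE -Dg Dpi ext_act_mul mulr_sumr.
  over.
rewrite exchange_big; apply: eq_bigr => i _ /=.
under eq_bigr => x _ do rewrite mulr_sumr.
rewrite exchange_big linear_sum rmorph_sum mulr_sumr; apply: eq_bigr => j _ /=.
rewrite linearZ iotaZ; have -> : kappa (c j) = h 0 j by rewrite mxE.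
rewrite Dh !(mulr_suml, mulr_sumr); apply: eq_bigr => x _; ring.
Qed.
End GrouplikeGroup.
End ActionBasis.
End ScalarExtension.

(** * Linearity of the trace, and general facts on valuations *)

Lemma trLK_linear (K : fieldType) (L : fieldExtType K) (a : K) (x y : L) :
  trLK (a *: x + y) = a * trLK x + trLK y.
Proof.
have amulrP : amulr (a *: x + y) = a *: amulr x + amulr y.
  apply/lfunP => z; rewrite add_lfunE scale_lfunE !lfunE /=.
  by rewrite mulrDr scalerAr.
by rewrite /trLK amulrP passmx.mxof_linear linearP.
Qed.

Section Valuation.
Variables (K : fieldType) (L : fieldExtType K) (v : L -> int).
Hypothesis valv : normalised_discrete_valuation v.

Lemma valM x y : x != 0 -> y != 0 -> v (x * y) = v x + v y.
Proof. by case: valv => vM _ _; apply: vM. Qed.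

Lemma val1 : v 1 = 0.
Proof.
have := valM (oner_neq0 L) (oner_neq0 L).
by rewrite mulr1 -{1}[v 1]addr0 => /addrI.
Qed.

Lemma valN x : v (- x) = v x.
Proof.
have [->|x_neq0] := eqVneq x 0; first by rewrite oppr0.
have N1_neq0 : -1 != 0 :> L by rewrite oppr_eq0 oner_eq0.
have := valM N1_neq0 N1_neq0; rewrite mulrNN mulr1 val1 => vN1.
rewrite -mulN1r valM //; lia.
Qed.

Lemma val_exprz x (z : int) : x != 0 -> v (x ^ z) = z * v x.
Proof.
move=> x_neq0.
have valX i : v (x ^+ i) = i%:Z * v x.
  elim: i => [|i IHi]; first by rewrite expr0 val1 mul0r.
  rewrite exprS valM ?expf_neq0 // IHi; lia.
case: z => i; first exact: valX.
have xV_neq0 : x ^- i.+1 != 0 by rewrite invr_eq0 expf_neq0.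
have := valM (expf_neq0 i.+1 x_neq0) xV_neq0.
rewrite mulfV ?expf_neq0 // val1 valX -[x ^ Negz i]/(x ^- i.+1) NegzE; lia.
Qed.

Lemma val_add_lt x y : x != 0 -> y != 0 -> v x < v y ->
  x + y != 0 /\ v (x + y) = v x.
Proof.
move=> x_neq0 y_neq0 ltxy; have [_ vD _] := valv.
have xy_neq0 : x + y != 0.
  by apply: contraTneq ltxy => /addr0_eq <-; rewrite valN ltxx.
split=> //; have := vD _ _ x_neq0 y_neq0 xy_neq0.
(* The upper bound on [v (x + y)] comes from writing [x] as [(x + y) - y]. *)
have := vD (x + y) (- y); rewrite addrK valN oppr_eq0.
move=> /(_ xy_neq0 y_neq0 x_neq0); lia.
Qed.

(** The term of least valuation dominates the sum. Zero terms are kept apart because [v 0] carries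
    no meaning; the left alternative is the case without nonzero terms. *)
Lemma val_sum_distinct (I : eqType) (s : seq I) (t : I -> L) :
  uniq s ->
  {in s &, forall i j, t i != 0 -> t j != 0 -> v (t i) = v (t j) -> i = j} ->
  {in s, forall i, t i = 0} \/
  exists2 j, j \in s &
    [/\ t j != 0, \sum_(i <- s) t i != 0, v (\sum_(i <- s) t i) = v (t j)
      & {in s, forall i, t i != 0 -> v (t j) <= v (t i)}].
Proof.
elim: s => [|i0 s IHs] /=; first by left.
case/andP=> i0_s uniq_s dist.
have dist_s : {in s &, forall i j,
    t i != 0 -> t j != 0 -> v (t i) = v (t j) -> i = j}.
  by move=> i j si sj; apply: dist; rewrite inE ?si ?sj orbT.
rewrite big_cons; have [ti0|ti0] := eqVneq (t i0) 0.
  rewrite ti0 add0r; case: (IHs uniq_s dist_s) => [s0|[j sj [tj s_neq0 vs minj]]].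
    by left=> i; rewrite inE => /predU1P[->|/s0].
  right; exists j; first by rewrite inE sj orbT.
  by split=> // i; rewrite inE => /predU1P[->|/minj//]; rewrite ti0 eqxx.
right; case: (IHs uniq_s dist_s) => [s0|[j sj [tj s_neq0 vs minj]]].
  rewrite big_seq big1 ?addr0 //; exists i0; rewrite ?mem_head //.
  by split=> // i; rewrite inE => /predU1P[-> //|/s0->]; rewrite eqxx.
have [lt_i0j|lt_ji0|eq_v] := ltgtP (v (t i0)) (v (t j)).
- have [] := val_add_lt ti0 s_neq0; first by rewrite vs.
  exists i0; rewrite ?mem_head //; split=> // i.
  by rewrite inE => /predU1P[-> //|/minj/[apply]/(lt_le_trans lt_i0j)/ltW].
- have [] := val_add_lt s_neq0 ti0; first by rewrite vs.
  rewrite addrC vs => neq0 vE; exists j; first by rewrite inE sj orbT.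
  by split=> // i; rewrite inE => /predU1P[-> _|/minj//]; apply: ltW.
have i0j : i0 = j by apply: dist => //; rewrite inE ?eqxx // sj orbT.
by rewrite i0j sj in i0_s.
Qed.

(** * Total ramification and the inverse different *)

Section TotallyRamified.
Hypothesis ramv : totally_ramified v.
Let n := \dim {:L}.

Lemma algZ_neq0 (a : K) : a != 0 -> a%:A != 0 :> L.
Proof. by move=> a_neq0; rewrite scaler_eq0 oner_eq0 orbF. Qed.

Lemma val_scale (a : K) x : a != 0 -> x != 0 ->
  exists q, v (a *: x) = q * n%:Z + v x.
Proof.
move=> a_neq0 x_neq0; case: ramv => /(_ a a_neq0)/dvdzP[q vaE] _; exists q.
by rewrite -vaE -valM ?algZ_neq0 // -scalerAl mul1r.
Qed.

(* The powers of a uniformiser form a K-basis of L whose nonzero multiples have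
   distinct valuations, so only the coefficient of 1 matters modulo pi S. *)
Lemma residue_approx s : inS v s ->
  exists a : K, s - a%:A = 0 \/ (s - a%:A != 0 /\ 1 <= v (s - a%:A)).
Proof.
case/predU1P=> [->|vs_ge0]; first by exists 0; left; rewrite scale0r subr0.
have [s0|s_neq0] := eqVneq s 0; first by exists 0; left; rewrite s0 scale0r subr0.
have [vs1|vs1] := leP 1 (v s); first by exists 0; right; rewrite scale0r subr0.
have vs : v s = 0 by lia.
have [_ _ /(_ 1)[pi pi_neq0 vpi]] := valv.
(* Scaling by [K] shifts valuations by multiples of [n], so a nonzero [c i *: pi ^+ i] has valuation
   congruent to [i], and [i < n] is recovered from it. *)
have dist (c : 'I_n -> K) (i j : 'I_n) : c i *: pi ^+ i != 0 ->
    c j *: pi ^+ j != 0 -> v (c i *: pi ^+ i) = v (c j *: pi ^+ j) -> i = j.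
  rewrite !scaler_eq0 !negb_or => /andP[ci pii] /andP[cj pij].
  have [q ->] := val_scale ci pii; have [r ->] := val_scale cj pij.
  rewrite !exprnP !val_exprz // vpi !mulr1 => eq_ij; apply: val_inj.
  have := congr1 (fun z => (z %% n%:Z)%Z) eq_ij.
  rewrite !modzMDl !modz_small ?lez_nat ?ltz_nat ?ltn_ord //.
  by case.
pose e := [tuple pi ^+ (i : 'I_n) | i < n].
have eE (i : 'I_n) : e`_i = pi ^+ i by rewrite -tnth_nth tnth_mktuple.
have free_e : free e.
  apply/freeP => c; under eq_bigr => i _ do rewrite eE.
  move=> sum0 i; pose t (i : 'I_n) := c i *: pi ^+ i.
  have := val_sum_distinct (enum_uniq 'I_n) (t := t).
  case=> [j k _ _|all0|[j _ []]]; first exact: dist.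
    have /eqP := all0 i (mem_enum _ _).
    by rewrite scaler_eq0 (expf_eq0 pi) (negPf pi_neq0) andbF orbF => /eqP.
  by rewrite big_enum /= sum0 eqxx.
have basis_e : basis_of {:L} e.
  by rewrite basisEfree free_e subvf size_tuple leqnn.
pose c i := coord e i s; pose t (i : 'I_n) := c i *: pi ^+ i.
have sE : s = \sum_i t i.
  rewrite {1}(coord_basis basis_e (memvf s)).
  by apply: eq_bigr => i _; rewrite eE.
have n_gt0 : (0 < n)%N by rewrite adim_gt0.
pose i0 := Ordinal n_gt0.
have t0 : t i0 = (c i0)%:A by rewrite /t expr0.
have sB : s - (c i0)%:A = \sum_(i <- rem i0 (enum 'I_n)) t i.
  rewrite sE -t0 -big_enum /= (perm_big _ (perm_to_rem (mem_enum _ i0))) big_cons /=.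
  by rewrite addrAC subrr add0r.
exists (c i0); rewrite {}sB.
have := val_sum_distinct (enum_uniq 'I_n) (t := t).
case=> [j k _ _|all0|[j _ [tj _ vsj minj]]]; first exact: dist.
  by case/eqP: s_neq0; rewrite sE big1 // => i _; apply: all0; rewrite mem_enum.
have := val_sum_distinct (rem_uniq i0 (enum_uniq 'I_n)) (t := t).
case=> [k l _ _|all0|[k sk [tk s'_neq0 -> _]]]; first exact: dist.
  by left; rewrite big_seq big1.
right; split=> //.
rewrite big_enum -sE vs in vsj.
(* All nonzero terms have valuation at least [v s = 0]. Valuation 0 occurs only at [j], which must
   be the index 0 by the congruence, and that term has been removed. *)
have := minj k (mem_enum _ _) tk; rewrite -vsj le_eqVlt => /orP[/eqP vk0|//].
have kj : k = j by apply: (dist c) => //; rewrite -/(t k) -/(t j) -vsj.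
suff jk : j = i0 by move: sk; rewrite kj jk mem_rem_uniqF ?enum_uniq.
apply: val_inj; move: tj vsj; rewrite /t scaler_eq0 negb_or => /andP[cj pij].
have [q ->] := val_scale cj pij; rewrite exprnP val_exprz // vpi mulr1.
move/(congr1 (fun z => (z %% n%:Z)%Z)).
by rewrite modzMDl mod0z modz_small ?lez_nat ?ltz_nat ?ltn_ord // => -[/esym].
Qed.

Lemma trace_neq0 w rho : different_valuation v w -> rho != 0 ->
  (v rho == - w - 1 %[mod n%:Z])%Z -> trLK rho != 0.
Proof.
move=> diffw rho_neq0; rewrite eqz_mod_dvd => /dvdzP[q vrho].
have [_ [a a_neq0 va]] := ramv.
have aA_neq0 := algZ_neq0 a_neq0.
(* As [v rho] is [- w - 1 + q * n] and [a] has valuation [n], the factor [a ^ (- q)] brings the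
   valuation to exactly [- w - 1]. *)
pose sigma := (a%:A) ^ (- q) * rho.
have sigma_neq0 : sigma != 0 by rewrite mulf_neq0 ?expfz_neq0.
have vsigma : v sigma = - w - 1.
  rewrite valM ?expfz_neq0 // val_exprz // va; lia.
have sigmaE : sigma = (a ^ (- q)) *: rho.
  by rewrite /sigma -(fmorphXz (in_alg L)) /= -scalerAl mul1r.
have tr0 : trLK (0 : L) = 0.
  by have := trLK_linear (-1) (0 : L) 0; rewrite scaler0 addr0 mulN1r addNr.
apply/negP => /eqP tr_rho.
have tr_sigma : trLK sigma = 0.
  by rewrite sigmaE -[_ *: _]addr0 trLK_linear tr_rho tr0 mulr0 addr0.
suff : in_inv_different v sigma.
  move/diffw => [/eqP|]; first by rewrite (negPf sigma_neq0).
  rewrite vsigma; lia.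
move=> s /residue_approx[c s'P]; set s' := s - c%:A in s'P.
have -> : sigma * s = c *: sigma + sigma * s'.
  by rewrite mulrBr -scalerAr mulr1 addrC subrK.
rewrite trLK_linear tr_sigma mulr0 add0r.
case: s'P => [->|[s'_neq0 vs']].
  by rewrite mulr0 tr0 /inR /inS scale0r eqxx.
(* Multiplication by [s'] raises the valuation to at least [- w], so the product lies in the inverse
   different; testing against [1] puts its trace in [R]. *)
have /diffw/(_ 1) : sigma * s' = 0 \/ - w <= v (sigma * s').
  by right; rewrite valM // vsigma; lia.
by rewrite mulr1; apply; rewrite /inS val1 lexx orbT.
Qed.
End TotallyRamified.
End Valuation.

(** * From nonzero trace to a normal basis over [K] *)

Theorem theorem2 (p : nat) (K : fieldType) (L : fieldExtType K)
  (v : L -> int) (w : int) (m : nat) (H : hopf_data K m)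
  (act : 'I_m -> 'End(L)) (b : int) :
  prime p -> p \in [pchar K] ->
  normalised_discrete_valuation v ->
  S_finite_over_R v ->
  different_valuation v w ->
  separable 1%VS {:L} ->
  is_H_Galois H act ->
  totally_ramified v ->
  (exists k : nat, \dim {:L} = (p ^ k)%N) ->
  (b == - w - 1 %[mod (\dim {:L})%:Z])%Z ->
  forall rho : L, rho != 0 -> v rho = b ->
  normal_basis_generator H act rho.

Proof.
move=> p_pr charK valv _ diffw sepL galH ramv [k dimL] b_mod rho rho_neq0 vrho.
have tr_neq0 : trLK rho != 0.
  by apply: (trace_neq0 valv ramv diffw rho_neq0); rewrite vrho.
have [free_A full_A] := galois_action_mx galH.
have Em : m = \dim {:L} by rewrite -(eqP free_A) (eqP full_A).
have [hopfH [modH _]] := galH.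
subst m; set A := \matrix_(_, _) _ in free_A.
have act_free (c : 'I_(\dim {:L}) -> K) :
    \sum_i c i *: act i rho = 0 -> forall i, c i = 0.
  (* Equality in [K] is decidable, so the goal can be turned into a contradiction; this absorbs the
     double negation in [separable_embeddings]. *)
  move=> c_rho i; apply/eqP/negPn/negP => ci; apply: (separable_embeddings sepL).
  case=> [E [iota [sigma [homs onto B_unit]]]]; case/negP: ci; apply/eqP.
  pose kappa : {rmorphism K -> E} := iota \o in_alg L.
  have kappaE a : iota a%:A = kappa a by [].
  have charE : p \in [pchar E] by rewrite (fmorph_pchar kappa).
  have A_unit : \matrix_(i, j) iota (act i (vbasis {:L})`_j) \in unitmx.
    have -> : \matrix_(i, j) iota (act i (vbasis {:L})`_j) = map_mx iota A.
      by apply/matrixP => i' j; rewrite !mxE.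
    by rewrite map_unitmx -row_free_unit.
  apply: (trace_neq0_act_free hopfH modH kappaE (vbasisP {:L}) A_unit homs onto
    B_unit p_pr charE dimL _ c_rho).
  by rewrite -(khom_trace rho homs B_unit) kappaE fmorph_eq0.
split=> [x|c c' eq_cc' i]; last first.
  apply/eqP; rewrite -subr_eq0; apply/eqP.
  apply: (act_free (fun i => c i - c' i)).
  under eq_bigr => j _ do rewrite scalerBl.
  by rewrite sumrB eq_cc' subrr.
(* There are exactly [\dim {:L}] vectors [act i rho], so their independence already makes them span
   [L]. *)
pose e := [tuple act i rho | i < \dim {:L}].
have eE (i : 'I_(\dim {:L})) : e`_i = act i rho by rewrite -tnth_nth tnth_mktuple.
have free_e : free e.
  apply/freeP => c; under eq_bigr => i _ do rewrite eE.
  exact: act_free.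
have basis_e : basis_of {:L} e by rewrite basisEfree free_e subvf size_tuple leqnn.
exists (fun i => coord e i x); rewrite {1}(coord_basis basis_e (memvf x)).
by apply: eq_bigr => i _; rewrite eE.
Qed.
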